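(* Let $(\mathcal{X},\mathrm{d})$ be a finite metric space, let $P$ be an irreducible stochastic matrix on $\mathcal{X}$ with unique invariant law $\pi$, and let $P^\star$ be the adjoint of $P$ in $L^2(\mathcal{X},\pi)$. Assume that $P$ has non-negative sectional curvature, in the following sense: for each $(x,y)\in\mathcal{X}^2$ there is a coupling $(X^\star,Y^\star)$ of $P^\star(x,\cdot)$ and $P^\star(y,\cdot)$ such that almost surely $\mathrm{d}(X^\star,Y^\star)\le \mathrm{d}(x,y)$. Let $\kappa\in\mathbb{R}$ be such that $$\forall \mu,\nu\in\mathcal{P}(\mathcal{X}),\qquad W(\mu P,\nu P)\le (1-\kappa)W(\mu,\nu).$$ Then, with the same constant $\kappa$, $$\forall \mu\in\mathcal{P}(\mathcal{X}),\qquad H(\mu P\,|\,\pi)\le (1-\kappa)H(\mu\,|\,\pi).$$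
   Context: $\mathcal{P}(\mathcal{X})$ is the set of probability measures on $\mathcal{X}$. The Wasserstein distance is $W(\mu,\nu):=\min_{X\sim\mu,Y\sim\nu}\mathbb{E}[\mathrm{d}(X,Y)]$, the minimum being over all couplings $(X,Y)$ of $\mu$ and $\nu$. The relative entropy is $H(\mu\,|\,\pi):=\sum_{x}\mu(x)\log(\mu(x)/\pi(x))$ (with $0\log 0=0$). $\mu P$ denotes the measure $(\mu P)(y)=\sum_x\mu(x)P(x,y)$. Explicitly $P^\star(x,y)=\pi(y)P(y,x)/\pi(x)$. Neither reversibility of $P$ nor any relation between the metric $\mathrm{d}$ and $P$ is assumed. *)

(* Defs.v *)
From HB Require Import structures.
From mathcomp Require Import all_boot all_order all_algebra.
From mathcomp Require Import all_classical all_reals all_analysis.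

Set Implicit Arguments.
Unset Strict Implicit.
Unset Printing Implicit Defensive.

Import Order.TTheory GRing.Theory Num.Theory.
Local Open Scope classical_set_scope.
Local Open Scope ring_scope.

#[short(type="finMetricType")]
HB.structure Definition FinMetric (K : numDomainType) :=
  { M of Finite M & Metric K M }.

(* Probability measures on a finite set are represented by their mass
   functions, transition kernels by functions T -> T -> R. *)
Section MarkovChains.
Context {R : realType} {T : finType}.
Implicit Types (mu nu pi : T -> R) (P : T -> T -> R).

Definition is_prob mu : Prop :=
  (forall x, 0 <= mu x) /\ \sum_x mu x = 1.

Definition prob_of mu (A : pred T) : R := \sum_(x | A x) mu x.

Definition stochastic P : Prop := forall x, is_prob (P x).

Fixpoint kernel_pow P (n : nat) (x y : T) : R :=
  if n is m.+1 then \sum_z P x z * kernel_pow P m z y else (x == y)%:R.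

Definition irreducible P : Prop := forall x y, exists n, 0 < kernel_pow P n x y.

Definition push mu P (y : T) : R := \sum_x mu x * P x y.

Definition invariant_law P pi : Prop :=
  is_prob pi /\ forall y, push pi P y = pi y.

Definition adjoint P pi (x y : T) : R := pi y * P y x / pi x.

(* [ln 0 = 0], hence the convention [0 log 0 = 0]; when pi is the invariant law
   of an irreducible kernel, it is positive and the division is a genuine one. *)
Definition rel_entropy mu pi : R := \sum_x mu x * ln (mu x / pi x).

End MarkovChains.

Section Couplings.
Context {R : realType} {T : finType}.
Implicit Types (mu nu : T -> R) (q : T * T -> R).

(* A coupling (X, Y) is represented by its joint law. *)
Definition coupling mu nu q : Prop :=
  [/\ is_prob q,
      forall x, \sum_y q (x, y) = mu x &
      forall y, \sum_x q (x, y) = nu y].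

End Couplings.

Section Transport.
Context {R : realType} {T : finMetricType R}.
Implicit Types (mu nu : T -> R) (P : T -> T -> R).

(* For probability measures mu and nu the couplings form a nonempty compact set
   on which the expected distance is continuous: the infimum is a minimum. *)
Definition wasserstein mu nu : R :=
  inf [set \sum_z q z * mdist z.1 z.2 | q in coupling mu nu].

Definition nonneg_sectional_curvature P pi : Prop :=
  forall x y : T, exists q : T * T -> R,
    coupling (adjoint P pi x) (adjoint P pi y) q /\
    prob_of q (fun z => mdist z.1 z.2 <= mdist x y) = 1.

End Transport.

(* Main.v *)
(** Write [G mu = H(mu P | pi) - theta * H(mu | pi)] with [theta > 1 - kappa],
    and let the positive law [mu] move to the law [mu'] whose log-density is,
    up to a constant, [P (ln (d(mu P) / d pi)) / theta]. The Gibbs variational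
    principle gives [G mu <= G mu']. Non-negative curvature makes
    [ln (d(mu P) / d pi)] at least as Lipschitz as [ln (d mu / d pi)], and the
    Wasserstein contraction, tested on Dirac masses, makes [P] contract
    Lipschitz constants by [1 - kappa]; so the Lipschitz constant of the
    log-density is multiplied by at most [(1 - kappa) / theta < 1]. Iterating,
    [G mu] is bounded by entropies of laws whose log-density relative to [pi]
    flattens out, hence [G mu <= 0]. It remains to let [theta] tend to
    [1 - kappa], and to reach laws with zeros by mixing them with [pi]. *)

Require Import Defs.
From HB Require Import structures.
From mathcomp Require Import all_boot all_order all_algebra.
From mathcomp Require Import all_classical all_reals all_analysis.
From mathcomp Require Import ring lra.

Import Order.TTheory GRing.Theory Num.Theory.
Import numFieldNormedType.Exports.
Local Open Scope ring_scope.

(** * Positivity of laws and of relative entropy on a finite set *)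

Section Entropy.
Context {R : realType} {T : finType}.
Implicit Types (mu nu pi u w : T -> R) (P : T -> T -> R).

Definition kernel_app P u (x : T) : R := \sum_y P x y * u y.

Definition tilt pi w (x : T) : R :=
  pi x * expR (w x) / \sum_z pi z * expR (w z).

Lemma sum_push mu P u :
  \sum_y push mu P y * u y = \sum_x mu x * kernel_app P u x.
Proof.
rewrite /push /kernel_app.
under eq_bigr do rewrite mulr_suml.
rewrite exchange_big /=; apply: eq_bigr => x _.
by rewrite mulr_sumr; apply: eq_bigr => y _; rewrite mulrA.
Qed.

Lemma is_prob_push mu P : stochastic P -> is_prob mu -> is_prob (push mu P).
Proof.
move=> stP [mu0 mu1]; split=> [y|].
  by apply: sumr_ge0 => x _; rewrite mulr_ge0 // (stP x).1.
rewrite exchange_big /= -mu1; apply: eq_bigr => x _.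
by rewrite -mulr_sumr (stP x).2 mulr1.
Qed.

(** If [push mu P y] were zero, positivity of [mu] would force the whole column [P x y] to vanish,
    and invariance would give [pi y = 0]. *)
Lemma push_gt0 mu P pi : stochastic P -> invariant_law P pi ->
  (forall x, 0 < pi x) -> (forall x, 0 < mu x) -> forall y, 0 < push mu P y.
Proof.
move=> stP [_ inv] pi0 mu0 y; rewrite lt_neqAle eq_sym.
have ge0 x : 0 <= mu x * P x y by rewrite mulr_ge0 ?(stP x).1 ?ltW.
rewrite sumr_ge0 ?andbT //.
apply/negP => /eqP /psumr_eq0P => /(_ (fun x _ => ge0 x)) eq0.
have := pi0 y; rewrite -inv /push big1 ?ltxx // => x _.
by move/eqP: (eq0 x isT); rewrite mulf_eq0 gt_eqF //= => /eqP ->; rewrite mulr0.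
Qed.

Lemma is_prob_delta (x : T) : is_prob (fun z => (z == x)%:R : R).
Proof.
split=> [z|]; first exact: ler0n.
by rewrite (bigD1 x) //= eqxx big1 ?addr0 // => z /negPf ->.
Qed.

Lemma sum_delta (x : T) u : \sum_z (z == x)%:R * u z = u x.
Proof.
rewrite (bigD1 x) //= eqxx mul1r big1 ?addr0 // => z /negPf ->.
by rewrite mul0r.
Qed.

(** Some point [x] carries mass, [pi] is invariant under all powers of [P], and irreducibility gives
    a power that sends part of the mass of [x] to [y]. *)
Lemma invariant_law_gt0 P pi : stochastic P -> irreducible P ->
  invariant_law P pi -> forall x, 0 < pi x.
Proof.
move=> stP irr [[pi0 pi1] inv] y.
have pow_inv n z : \sum_x pi x * kernel_pow P n x z = pi z.
  elim: n z => [|n IHn] z /=.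
    by rewrite -[RHS](sum_delta z pi); apply: eq_bigr => x _; rewrite mulrC.
  rewrite -[RHS]IHn.
  rewrite -(eq_bigr _ (fun x _ => congr1 ( *%R^~ (kernel_pow P n x z)) (inv x))).
  by rewrite sum_push.
have pow_ge0 n x z : 0 <= kernel_pow P n x z.
  elim: n x => [|n IHn] x /=; first exact: ler0n.
  by apply: sumr_ge0 => t _; rewrite mulr_ge0 ?(stP x).1.
have [x pix] : exists x, 0 < pi x.
  apply: contrapT => no; have := oner_neq0 R; rewrite -pi1 big1 ?eqxx // => x _.
  by apply/eqP; rewrite eq_le pi0 andbT leNgt; apply/negP => ?; apply: no; exists x.
have [n Pn] := irr x y.
rewrite -(pow_inv n) (bigD1 x) //= ltr_pwDl ?mulr_gt0 //.
by apply: sumr_ge0 => z _; rewrite mulr_ge0.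
Qed.

Lemma ln_le_subr1 (t : R) : 0 < t -> ln t <= t - 1.
Proof.
by move=> t0; rewrite -[X in ln X](subrKC 1) le_ln1Dx // ltrBrDl subrr.
Qed.

Lemma subr1V_le_ln (t : R) : 0 < t -> 1 - t^-1 <= ln t.
Proof.
move=> t0; rewrite -[leRHS]opprK -lnV ?posrE // -opprB lerN2.
by rewrite ln_le_subr1 ?invr_gt0.
Qed.

(** From [1 - 1/t <= ln t], each term is at least [mu x - nu x], and these differences sum to
    zero. *)
Lemma rel_entropy_ge0 mu nu : is_prob mu -> is_prob nu ->
  (forall x, 0 < nu x) -> 0 <= rel_entropy mu nu.
Proof.
move=> [mu0 mu1] [_ nu1] nu0.
rewrite -(subrr 1) -{1}mu1 -nu1 -sumrB; apply: ler_sum => x _.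
have := mu0 x; rewrite le_eqVlt => /predU1P[<-|mux].
  by rewrite mul0r sub0r oppr_le0 ltW.
have := subr1V_le_ln _ (divr_gt0 mux (nu0 x)).
by move/(ler_wpM2l (mu0 x)); rewrite invf_div mulrBr mulr1 mulrCA divff ?gt_eqF ?mulr1.
Qed.

Lemma rel_entropy_split mu nu pi : (forall x, 0 <= mu x) ->
  (forall x, 0 < nu x) -> (forall x, 0 < pi x) ->
  rel_entropy mu pi = rel_entropy mu nu + \sum_x mu x * ln (nu x / pi x).
Proof.
move=> mu0 nu0 pi0; rewrite -big_split; apply: eq_bigr => x _ /=.
have := mu0 x; rewrite le_eqVlt => /predU1P[<-|mux]; first by rewrite !mul0r addr0.
rewrite -mulrDr -lnM ?posrE ?divr_gt0 //.
by rewrite mulrA divfK ?gt_eqF.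
Qed.

(** * Exponential tilts and the Gibbs variational principle *)

Section Tilt.
Variables (pi w : T -> R).
Hypotheses (pi_prob : is_prob pi) (pi_gt0 : forall x, 0 < pi x).
Let Z := \sum_z pi z * expR (w z).

Lemma partition_gt0 : 0 < Z.
Proof.
have ge0 x : 0 <= pi x * expR (w x) by rewrite mulr_ge0 ?expR_ge0 ?ltW.
rewrite lt_neqAle sumr_ge0 // andbT eq_sym.
apply/negP => /eqP /psumr_eq0P => /(_ (fun x _ => ge0 x)) eq0.
have := oner_neq0 R; rewrite -pi_prob.2 big1 ?eqxx // => x _.
by have := eq0 x isT; move/eqP; rewrite mulf_eq0 !gt_eqF ?expR_gt0.
Qed.

Lemma tilt_gt0 x : 0 < tilt pi w x.
Proof. by rewrite divr_gt0 ?mulr_gt0 ?expR_gt0 ?partition_gt0. Qed.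

Lemma is_prob_tilt : is_prob (tilt pi w).
Proof.
split=> [x|]; first exact/ltW/tilt_gt0.
by rewrite -mulr_suml divff ?gt_eqF ?partition_gt0.
Qed.

Lemma ln_tilt x : ln (tilt pi w x / pi x) = w x - ln Z.
Proof.
rewrite /tilt -/Z mulrAC [_ / pi x]mulrAC divff ?gt_eqF // mul1r.
by rewrite ln_div ?posrE ?expR_gt0 ?partition_gt0 // expRK.
Qed.

(** The Gibbs variational principle with its exact defect: the entropy relative to the tilted law is
    non-negative and vanishes at that law. *)
Lemma rel_entropy_tilt mu : is_prob mu ->
  rel_entropy mu pi = rel_entropy mu (tilt pi w) + \sum_x mu x * w x - ln Z.
Proof.
move=> [mu0 mu1]; rewrite (rel_entropy_split mu (tilt pi w)) //; last exact: tilt_gt0.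
rewrite -addrA; congr (_ + _).
under eq_bigr do rewrite ln_tilt mulrBr.
by rewrite sumrB -mulr_suml mu1 mul1r.
Qed.

End Tilt.

Lemma rel_entropy_refl mu : (forall x, 0 < mu x) -> rel_entropy mu mu = 0.
Proof. by move=> mu0; apply: big1 => x _; rewrite divff ?gt_eqF // ln1 mulr0. Qed.

Definition entropy_gap P pi (theta : R) mu : R :=
  rel_entropy (push mu P) pi - theta * rel_entropy mu pi.

(** For [theta > 0] this is the maximizer over laws [m] of [entropy_gap] with its first entropy
    replaced by [\sum_y push m P y * ln (push mu P y / pi y)]. *)
Definition tilt_step P pi (theta : R) mu : T -> R :=
  tilt pi (fun x => kernel_app P (fun y => ln (push mu P y / pi y)) x / theta).

(* Both sides are compared with [theta * ln Z], [Z] being the normalization of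
   the tilted law: the left one by Donsker and Varadhan's inequality, the right
   one because the tilted law attains equality there while
   [H(nu P | pi) >= \sum_y (nu P)(y) * ln ((mu P)(y) / pi y)]. *)
Lemma entropy_gap_tilt mu P pi (theta : R) : 0 < theta -> stochastic P ->
  is_prob mu -> is_prob pi -> (forall x, 0 < pi x) ->
  (forall y, 0 < push mu P y) ->
  entropy_gap P pi theta mu <= entropy_gap P pi theta (tilt_step P pi theta mu).
Proof.
move=> th0 stP mup pip pi0 muP0; rewrite /entropy_gap /tilt_step.
set g := kernel_app P _; set nu := tilt pi _.
have nup : is_prob nu by exact: is_prob_tilt.
have scale (m : T -> R) : theta * (\sum_x m x * (g x / theta)) = \sum_x m x * g x.
  rewrite mulr_sumr; apply: eq_bigr => x _.
  by rewrite mulrCA [theta * _]mulrC divfK ?gt_eqF.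
rewrite (rel_entropy_tilt pi (fun x => g x / theta) pip pi0 _ mup).
rewrite (rel_entropy_tilt pi (fun x => g x / theta) pip pi0 _ nup).
rewrite -/nu (rel_entropy_refl nu); last by move=> x; exact: tilt_gt0.
rewrite add0r !mulrBr mulrDr !scale /rel_entropy -/(rel_entropy mu nu) sum_push -/g.
have muH : 0 <= theta * rel_entropy mu nu.
  by rewrite mulr_ge0 ?(ltW th0) // rel_entropy_ge0 // => x; apply: tilt_gt0.
rewrite -/(rel_entropy (push nu P) pi).
rewrite (rel_entropy_split (push nu P) (push mu P)) //; last first.
  exact: (is_prob_push _ _ stP nup).1.
rewrite sum_push -/g.
have := rel_entropy_ge0 _ _ (is_prob_push _ _ stP nup) (is_prob_push _ _ stP mup) muP0.
lra.
Qed.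

(** * Mixing with the reference law, and its effect on entropy *)

Definition mix (e : R) mu pi (x : T) : R := (1 - e) * mu x + e * pi x.

Lemma mix_gt0 e mu pi : 0 < e < 1 -> (forall x, 0 <= mu x) ->
  (forall x, 0 < pi x) -> forall x, 0 < mix e mu pi x.
Proof.
move=> /andP[e0 e1] mu0 pi0 x.
by rewrite ltr_wpDl ?mulr_gt0 // mulr_ge0 // subr_ge0 ltW.
Qed.

Lemma is_prob_mix e mu pi : 0 < e < 1 -> is_prob mu -> is_prob pi ->
  is_prob (mix e mu pi).
Proof.
move=> /andP[/ltW e0 /ltW e1] [mu0 mu1] [pi0 pi1]; split=> [x|].
  by rewrite addr_ge0 ?mulr_ge0 ?subr_ge0.
by rewrite big_split -!mulr_sumr /= mu1 pi1 !mulr1 subrK.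
Qed.

Lemma push_mix e mu pi P : invariant_law P pi ->
  push (mix e mu pi) P = mix e (push mu P) pi.
Proof.
move=> [_ inv]; apply/funext => y; rewrite /mix -[in RHS]inv /push !mulr_sumr.
by rewrite -big_split; apply: eq_bigr => x _ /=; rewrite mulrDl !mulrA.
Qed.

(** Convexity, with [H(pi | pi) = 0]: the average of the entropies of [mu] and [pi] exceeds that of
    the mixture by the average of their entropies relative to the mixture. *)
Lemma rel_entropy_mix_le e mu pi : 0 < e < 1 -> is_prob mu -> is_prob pi ->
  (forall x, 0 < pi x) ->
  rel_entropy (mix e mu pi) pi <= (1 - e) * rel_entropy mu pi.
Proof.
move=> e01 mup pip pi0; have [e0 e1] := andP e01.
have mix0 := mix_gt0 _ _ _ e01 mup.1 pi0.
have mixp := is_prob_mix _ _ _ e01 mup pip.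
have -> : rel_entropy (mix e mu pi) pi =
    (1 - e) * (\sum_x mu x * ln (mix e mu pi x / pi x)) +
    e * (\sum_x pi x * ln (mix e mu pi x / pi x)).
  rewrite !mulr_sumr -big_split; apply: eq_bigr => x _ /=.
  by rewrite {1}/mix mulrDl !mulrA.
have := rel_entropy_split _ _ _ (fun x => ltW (pi0 x)) mix0 pi0.
rewrite rel_entropy_refl // (rel_entropy_split mu _ _ mup.1 mix0 pi0) => pi_split.
have Hmu := rel_entropy_ge0 _ _ mup mixp mix0.
have Hpi := rel_entropy_ge0 _ _ pip mixp mix0.
rewrite mulrDr -lerBrDl addrK.
have : 0 <= (1 - e) * rel_entropy mu (mix e mu pi) by rewrite mulr_ge0 // subr_ge0 ltW.
apply: le_trans; rewrite pmulr_rle0 //; lra.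
Qed.

(** The mixture dominates each of its components [(1 - e) * mu] and [e * pi], so the logarithm can
    be bounded below separately on each. *)
Lemma rel_entropy_mix_ge e mu pi : 0 < e < 1 -> is_prob mu -> is_prob pi ->
  (forall x, 0 < pi x) ->
  (1 - e) * rel_entropy mu pi + (1 - e) * ln (1 - e) + e * ln e <=
  rel_entropy (mix e mu pi) pi.
Proof.
move=> e01 mup pip pi0; have [e0 e1] := andP e01.
have mix0 := mix_gt0 _ _ _ e01 mup.1 pi0.
have e1' : 0 < 1 - e by rewrite subr_gt0.
have massE (m : T -> R) c : is_prob m -> c = \sum_x m x * c.
  by case=> _ m1; rewrite -mulr_suml m1 mul1r.
rewrite (massE mu (ln (1 - e)) mup) (massE pi (ln e) pip) /rel_entropy.
rewrite !mulr_sumr -!big_split; apply: ler_sum => x _ /=.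
rewrite [leRHS](_ : _ = (1 - e) * mu x * ln (mix e mu pi x / pi x) +
  e * (pi x * ln (mix e mu pi x / pi x))); last by rewrite {1}/mix mulrDl !mulrA.
apply: lerD.
  have := mup.1 x; rewrite le_eqVlt => /predU1P[<-|mux].
    by rewrite !(mul0r, mulr0, addr0).
  rewrite -!mulrDr -mulrA !ler_pM2l // addrC -lnM ?posrE ?divr_gt0 //.
  have mupi : 0 < mu x / pi x by rewrite divr_gt0.
  rewrite ler_ln ?posrE ?(mulr_gt0 e1' mupi) ?divr_gt0 // mulrA.
  by rewrite ler_pM2r ?invr_gt0 // lerDl mulr_ge0 ?ltW.
rewrite !ler_pM2l // ler_ln ?posrE ?divr_gt0 // ler_pdivlMr // lerDr.
by rewrite mulr_ge0 ?(ltW e1') // mup.1.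
Qed.

(** The weight is a square because [1 - 1/t <= ln t], used at [t = d], bounds [d ^+ 2 * ln (d ^+ 2)]
    below by [- (2 * d)]; used at [t = d ^+ 2] it gives a bound that does not vanish with [d]. *)
Lemma binary_entropy_le (d : R) : 0 < d < 1 ->
  - (3 * d) <= (1 - d ^+ 2) * ln (1 - d ^+ 2) + d ^+ 2 * ln (d ^+ 2).
Proof.
move=> /andP[d0 d1].
have dd : d ^+ 2 <= d by rewrite expr2 ger_pMl // ltW.
have e1 : 0 < 1 - d ^+ 2 by rewrite subr_gt0 (le_lt_trans dd).
have := subr1V_le_ln _ e1 => /(ler_wpM2l (ltW e1)).
rewrite mulrBr mulr1 divff ?gt_eqF // => le1.
have := subr1V_le_ln _ d0 => /(ler_wpM2l (ltW d0)).
rewrite mulrBr mulr1 divff ?gt_eqF // => /(ler_wpM2l (ltW d0)) le2.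
rewrite lnXn // mulr2n; have := sqr_ge0 d; nra.
Qed.

End Entropy.

(** * Lipschitz functions and the Wasserstein distance *)

Section Transport.
Context {R : realType} {X : finMetricType R}.
Implicit Types (mu nu pi u v : X -> R) (P : X -> X -> R).

Definition lip_le (L : R) u : Prop := forall x y, u x - u y <= L * mdist x y.

Lemma coupling_product mu nu : is_prob mu -> is_prob nu ->
  coupling mu nu (fun z => mu z.1 * nu z.2).
Proof.
move=> [mu0 mu1] [nu0 nu1]; split=> [|x|y] /=.
- split=> [z|]; first exact: mulr_ge0.
  rewrite -(pair_bigA _ (fun x y => mu x * nu y)) /= -mu1.
  by apply: eq_bigr => x _; rewrite -mulr_sumr nu1 mulr1.
- by rewrite -mulr_sumr nu1 mulr1.
- by rewrite -mulr_suml mu1 mul1r.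
Qed.

Lemma sum_coupling mu nu (q : X * X -> R) u v : coupling mu nu q ->
  \sum_x mu x * u x + \sum_y nu y * v y = \sum_z q z * (u z.1 + v z.2).
Proof.
move=> [_ q1 q2].
under [RHS]eq_bigr do rewrite mulrDr.
rewrite big_split /=; congr (_ + _).
  under eq_bigr do rewrite -q1 mulr_suml.
  by rewrite pair_bigA /=; apply: eq_bigr => -[a b].
under eq_bigr do rewrite -q2 mulr_suml.
by rewrite exchange_big pair_bigA /=; apply: eq_bigr => -[a b].
Qed.

(** The easy half of Kantorovich duality: integrate the Lipschitz bound against any coupling. *)
Lemma lip_le_wasserstein L mu nu u : 0 <= L -> is_prob mu -> is_prob nu ->
  lip_le L u ->
  \sum_x mu x * u x - \sum_x nu x * u x <= L * wasserstein mu nu.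
Proof.
move=> L0 mup nup Lu.
have cost q : coupling mu nu q ->
    \sum_x mu x * u x - \sum_x nu x * u x <= L * \sum_z q z * mdist z.1 z.2.
  move=> qc; have [[q0 _] _ _] := qc.
  rewrite -sumrN; under [X in _ + X]eq_bigr do rewrite -mulrN.
  rewrite (sum_coupling _ _ _ _ (fun y => - u y) qc) mulr_sumr; apply: ler_sum => z _.
  by rewrite mulrCA ler_wpM2l.
(* The product coupling makes the set of costs nonempty, as [lb_le_inf] requires; it also settles
   [L = 0], where one cannot divide by [L]. *)
have qc := coupling_product _ _ mup nup.
move: L0; rewrite le_eqVlt => /predU1P[L0|L0].
  by have := cost _ qc; rewrite -L0 !mul0r.
rewrite mulrC -ler_pdivrMr //; apply: lb_le_inf.
  by exists (\sum_z (mu z.1 * nu z.2) * mdist z.1 z.2); exists (fun z => mu z.1 * nu z.2).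
by move=> _ [q /cost qcost <-]; rewrite ler_pdivrMr // mulrC.
Qed.

Lemma wasserstein_ge0 mu nu : is_prob mu -> is_prob nu -> 0 <= wasserstein mu nu.
Proof.
move=> mup nup; have lip0 : lip_le 1 (fun _ => 0).
  by move=> x y; rewrite subr0 mul1r mdist_ge0.
have := lip_le_wasserstein _ _ _ _ ler01 mup nup lip0.
by rewrite -sumrB mul1r; under eq_bigr do rewrite !mulr0 subr0; rewrite big1.
Qed.

(** The product coupling gives the upper bound, the 1-Lipschitz function [mdist ^~ y] the lower
    one. *)
Lemma wasserstein_delta (x y : X) :
  wasserstein (fun z => (z == x)%:R) (fun z => (z == y)%:R) = mdist x y.
Proof.
apply/eqP; rewrite eq_le; apply/andP; split.
  apply: ge_inf.
    exists 0 => _ [q [[q0 _] _ _] <-].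
    by apply: sumr_ge0 => z _; rewrite mulr_ge0 ?mdist_ge0.
  exists (fun z => (z.1 == x)%:R * (z.2 == y)%:R).
    exact: coupling_product (is_prob_delta x) (is_prob_delta y).
  rewrite (bigD1 (x, y)) //= !eqxx !mul1r big1 ?addr0 // => -[a b].
  by rewrite xpair_eqE negb_and => /orP[]/negPf ->; rewrite ?mul0r ?mulr0 ?mul0r.
rewrite -[leRHS]mul1r; set W := wasserstein _ _.
have lip_dist : lip_le 1 (fun z => mdist z y).
  by move=> a b; rewrite mul1r lerBlDr metric_triangle.
have := lip_le_wasserstein _ _ _ _ ler01 (is_prob_delta x) (is_prob_delta y) lip_dist.
by rewrite !sum_delta mdistxx subr0.
Qed.

(** Two laws of equal mass have a point where the density is at most 1; from there the log-density
    climbs by at most [L * D]. *)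
Lemma lip_le_rel_entropy L D mu pi : 0 <= L -> is_prob mu -> is_prob pi ->
  (forall x, 0 < mu x) -> (forall x, 0 < pi x) ->
  (forall x y : X, mdist x y <= D) -> lip_le L (fun x => ln (mu x / pi x)) ->
  rel_entropy mu pi <= L * D.
Proof.
move=> L0 [mu0 mu1] [_ pi1] mupos pi0 dD Lmu.
have [x0 le0] : exists x, mu x <= pi x.
  apply: contrapT => no.
  have [x _] : exists x : X, True.
    apply: contrapT => nox; have := oner_neq0 R.
    by rewrite -mu1 big1 ?eqxx // => x _; case: nox; exists x.
  have lt z : pi z < mu z by rewrite ltNge; apply/negP => ?; apply: no; exists z.
  have : \sum_x pi x < \sum_x mu x.
    by apply: ltr_sum => //; apply/hasP; exists x; rewrite ?mem_index_enum.
  by rewrite mu1 pi1 ltxx.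
rewrite -[leRHS]mul1r -mu1 mulr_suml; apply: ler_sum => x _.
rewrite ler_wpM2l // -[leLHS](subrK (ln (mu x0 / pi x0))) -[leRHS]addr0 lerD //.
  by rewrite (le_trans (Lmu x x0)) // ler_wpM2l.
by rewrite ln_le0 // ler_pdivrMr ?mul1r.
Qed.

Lemma lip_le_exists u : exists2 L, 0 <= L & lip_le L u.
Proof.
pose F (z : X * X) := `|u z.1 - u z.2| / mdist z.1 z.2.
have F0 z : 0 <= F z by rewrite divr_ge0 ?mdist_ge0.
exists (\sum_z F z); first exact: sumr_ge0.
move=> x y; have [->|xy] := eqVneq x y; first by rewrite subrr mdistxx mulr0.
rewrite -ler_pdivrMr ?mdist_gt0 // (bigD1 (x, y)) //= -[leLHS]addr0.
rewrite lerD ?sumr_ge0 // ler_pM2r ?invr_gt0 ?mdist_gt0 //; exact: ler_norm.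
Qed.

(** * Propagation of Lipschitz constants and contraction of entropy *)

Section Contraction.
Variables (P : X -> X -> R) (pi : X -> R) (kappa : R).
Hypotheses (stP : stochastic P) (irrP : irreducible P)
  (pi_inv : invariant_law P pi)
  (curvP : nonneg_sectional_curvature P pi)
  (contrP : forall mu nu : X -> R, is_prob mu -> is_prob nu ->
    wasserstein (push mu P) (push nu P) <= (1 - kappa) * wasserstein mu nu).

Let pi_gt0 : forall x, 0 < pi x := invariant_law_gt0 _ _ stP irrP pi_inv.

Lemma wasserstein_kernel_le x y :
  wasserstein (P x) (P y) <= (1 - kappa) * mdist x y.
Proof.
have pushE z : push (fun t => (t == z)%:R) P = P z.
  by apply/funext => t; rewrite /push (sum_delta z (P^~ t)).
have := contrP _ _ (is_prob_delta x) (is_prob_delta y).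
by rewrite !pushE wasserstein_delta.
Qed.

Lemma contraction_factor_ge0 (x y : X) : x != y -> 0 <= 1 - kappa.
Proof.
rewrite -mdist_gt0 => xy; rewrite -(pmulr_lge0 _ xy).
exact: le_trans (wasserstein_ge0 _ _ (stP x) (stP y)) (wasserstein_kernel_le x y).
Qed.

Lemma kernel_app_lip L u : 0 <= L -> lip_le L u ->
  lip_le ((1 - kappa) * L) (kernel_app P u).
Proof.
move=> L0 Lu x y; rewrite mulrAC.
apply: le_trans (lip_le_wasserstein _ _ _ _ L0 (stP x) (stP y) Lu) _.
by rewrite mulrC ler_wpM2r // wasserstein_kernel_le.
Qed.

(** This is how the adjoint enters: it transports densities relative to [pi], so couplings of its
    rows compare the density of [push mu P] at two points. *)
Lemma push_density mu y :
  push mu P y / pi y = \sum_x adjoint P pi y x * (mu x / pi x).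
Proof.
rewrite mulr_suml; apply: eq_bigr => x _; rewrite /adjoint.
by field; rewrite !gt_eqF.
Qed.

(** With [f] the density of [mu], coupled points satisfy [f a <= f b * expR (L * mdist a b)]. Since
    almost surely [mdist a b <= mdist x y], the factor is bounded by a constant, which survives
    averaging over the coupling. *)
Lemma push_ln_lip L mu : 0 <= L -> (forall x, 0 < mu x) ->
  lip_le L (fun x => ln (mu x / pi x)) ->
  lip_le L (fun x => ln (push mu P x / pi x)).
Proof.
move=> L0 mu0 Lmu x y.
have f0 z : 0 < mu z / pi z by rewrite divr_gt0.
have g0 z : 0 < push mu P z / pi z.
  by rewrite divr_gt0 ?(push_gt0 _ _ _ stP pi_inv pi_gt0 mu0).
suff le_exp : push mu P x / pi x <= push mu P y / pi y * expR (L * mdist x y).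
  rewrite /= lerBlDl -[X in _ + X]expRK -lnM ?posrE ?expR_gt0 //.
  by rewrite ler_ln ?posrE ?(mulr_gt0 (g0 y) (expR_gt0 _)).
have [q [[[q0 q1] qx qy] qd]] := curvP x y.
have q_far z : ~~ (mdist z.1 z.2 <= mdist x y) -> q z = 0.
  move: q1; rewrite (bigID (fun z => mdist z.1 z.2 <= mdist x y)) /=.
  rewrite -/(prob_of q _) qd -[RHS]addr0 => /addrI.
  by move/psumr_eq0P => /(_ (fun z _ => q0 z)); apply.
rewrite !push_density.
under eq_bigr do rewrite -qx mulr_suml.
rewrite mulr_suml.
under [leRHS]eq_bigr do rewrite -qy mulr_suml mulr_suml.
rewrite [leRHS]exchange_big /=; apply: ler_sum => a _; apply: ler_sum => b _.
have [ab|/q_far ->] := boolP (mdist (a, b).1 (a, b).2 <= mdist x y); last first.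
  by rewrite !mul0r.
rewrite -mulrA ler_wpM2l //.
rewrite -[leLHS]lnK ?posrE // -{1}[mu b / pi b]lnK ?posrE // -expRD ler_expR.
rewrite -lerBlDl (le_trans (Lmu a b)) // ler_wpM2l //.
Qed.

Lemma tilt_step_lip L theta mu : 0 <= L -> 0 < theta -> (forall x, 0 < mu x) ->
  lip_le L (fun x => ln (mu x / pi x)) ->
  lip_le ((1 - kappa) / theta * L)
    (fun x => ln (tilt_step P pi theta mu x / pi x)).
Proof.
move=> L0 th0 mu0 Lmu x y /=; rewrite !ln_tilt //; try exact: pi_inv.1.
rewrite opprB addrA subrK -mulrBl ler_pdivrMr // [_ / _ * L]mulrAC -[leRHS]mulrA.
rewrite [_ * theta]mulrC [leRHS]mulrA divfK ?gt_eqF //.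
exact: (kernel_app_lip _ _ L0 (push_ln_lip _ _ L0 mu0 Lmu)).
Qed.

(** Induction over all [L] and [mu] at once: each tilt moves one factor of the power into the
    Lipschitz constant. For [n = 0] the gap is at most the entropy of [push mu P]. *)
Lemma entropy_gap_le L D theta mu n : 0 <= 1 - kappa -> 0 < theta -> 0 <= L ->
  is_prob mu -> (forall x, 0 < mu x) -> (forall x y : X, mdist x y <= D) ->
  lip_le L (fun x => ln (mu x / pi x)) ->
  entropy_gap P pi theta mu <= ((1 - kappa) / theta) ^+ n * (L * D).
Proof.
move=> k0 th0 + + + dD; elim: n L mu => [|n IHn] L mu L0 mup mu0 Lmu.
  have muPp := is_prob_push _ _ stP mup.
  have muP0 := push_gt0 _ _ _ stP pi_inv pi_gt0 mu0.
  have := lip_le_rel_entropy _ _ _ _ L0 muPp pi_inv.1 muP0 pi_gt0 dD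
    (push_ln_lip _ _ L0 mu0 Lmu).
  have := mulr_ge0 (ltW th0) (rel_entropy_ge0 _ _ mup pi_inv.1 pi_gt0).
  rewrite expr0 mul1r /entropy_gap; lra.
apply: le_trans (entropy_gap_tilt _ _ _ _ th0 stP mup pi_inv.1 pi_gt0
  (push_gt0 _ _ _ stP pi_inv pi_gt0 mu0)) _.
rewrite exprSr -mulrA [_ / theta * _]mulrA; apply: IHn.
- by rewrite mulr_ge0 // divr_ge0 // ltW.
- exact: is_prob_tilt pi_inv.1 pi_gt0.
- exact: tilt_gt0 pi_inv.1 pi_gt0.
- exact: tilt_step_lip.
Qed.

Lemma entropy_gap_le0 theta mu : 0 <= 1 - kappa < theta ->
  is_prob mu -> (forall x, 0 < mu x) -> entropy_gap P pi theta mu <= 0.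
Proof.
move=> /andP[k0 kth] mup mu0; have th0 := le_lt_trans k0 kth.
have [L L0 Lmu] := lip_le_exists (fun x => ln (mu x / pi x)).
pose D : R := \sum_(z : X * X) mdist z.1 z.2.
have dD (x y : X) : mdist x y <= D.
  rewrite /D (bigD1 (x, y)) //= lerDl sumr_ge0 // => z _; exact: mdist_ge0.
have lim0 : (((1 - kappa) / theta) ^+ n * (L * D) @[n --> \oo] --> 0 * (L * D))%classic.
  apply: cvgMr_tmp; apply: cvg_expr.
  by rewrite ger0_norm ?(divr_ge0 k0 (ltW th0)) // ltr_pdivrMr // mul1r.
rewrite -[leRHS](mul0r (L * D)); apply: (cvgr_to_ge lim0).
by apply: nearW => n; exact: entropy_gap_le.
Qed.

Lemma entropy_contraction_pos mu : 0 <= 1 - kappa ->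
  is_prob mu -> (forall x, 0 < mu x) ->
  rel_entropy (push mu P) pi <= (1 - kappa) * rel_entropy mu pi.
Proof.
move=> k0 mup mu0; rewrite -subr_le0; set H := rel_entropy mu pi.
have H0 : 0 <= H := rel_entropy_ge0 _ _ mup pi_inv.1 pi_gt0.
apply/ler_addgt0Pl => e e0; rewrite addr0.
(* The excess of [theta] over [1 - kappa] costs [e / (H + 1) * H <= e]; the [+ 1] keeps the quotient
   genuine when [H = 0]. *)
have th : 0 <= 1 - kappa < 1 - kappa + e / (H + 1).
  by rewrite k0 ltrDl divr_gt0 // ltr_wpDl.
have := entropy_gap_le0 _ _ th mup mu0; rewrite /entropy_gap -/H mulrDl.
have : e / (H + 1) * H <= e.
  rewrite mulrAC ler_pdivrMr ?ltr_wpDl // ler_wpM2l ?(ltW e0) //; lra.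
lra.
Qed.

Lemma entropy_contraction mu : 0 <= 1 - kappa -> is_prob mu ->
  rel_entropy (push mu P) pi <= (1 - kappa) * rel_entropy mu pi.
Proof.
move=> k0 mup; rewrite -subr_le0 leNgt; apply/negP.
(* Mixing with weight [d ^+ 2] will give [(1 - d ^+ 2) * A <= 3 * d]. This [d] solves
   [(1 - d) * A = 4 * d], so the left side is [4 * d * (1 + d)], a contradiction. *)
set A := _ - _ => A0; pose d := A / (A + 4).
have A4 : 0 < A + 4 by rewrite addr_gt0.
have dA : d * (A + 4) = A by rewrite divfK ?gt_eqF.
have d0 : 0 < d by rewrite divr_gt0.
have d1 : d < 1 by rewrite ltr_pdivrMr // mul1r ltrDl.
have d01 : 0 < d < 1 by rewrite d0.
have e01 : 0 < d ^+ 2 < 1 by rewrite exprn_gt0 // exprn_ilt1 // ltW.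
have pip := pi_inv.1.
have := entropy_contraction_pos _ k0 (is_prob_mix _ _ _ e01 mup pip)
  (mix_gt0 _ _ _ e01 mup.1 pi_gt0).
rewrite push_mix //.
have := rel_entropy_mix_ge _ _ _ e01 (is_prob_push _ _ stP mup) pip pi_gt0.
have /(ler_wpM2l k0) := rel_entropy_mix_le _ _ _ e01 mup pip pi_gt0.
have := binary_entropy_le _ d01.
move=> h1 h2 h3 h4.
have : (1 - d ^+ 2) * A <= 3 * d by rewrite /A; lra.
nra.
Qed.

End Contraction.

End Transport.

Theorem theorem1 (R : realType) (X : finMetricType R)
  (P : X -> X -> R) (pi : X -> R) (kappa : R)
  (P_stochastic : stochastic P)
  (P_irreducible : irreducible P)
  (pi_invariant : invariant_law P pi)
  (P_curvature : nonneg_sectional_curvature P pi)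
  (P_contraction : forall mu nu : X -> R, is_prob mu -> is_prob nu ->
    wasserstein (push mu P) (push nu P) <= (1 - kappa) * wasserstein mu nu) :
  forall mu : X -> R, is_prob mu ->
    rel_entropy (push mu P) pi <= (1 - kappa) * rel_entropy mu pi.
Proof.
move=> mu mup.
have [[x [y xy]]|single] := pselect (exists x y : X, x != y).
  apply: entropy_contraction => //.
  exact: (contraction_factor_ge0 _ _ P_stochastic P_contraction _ _ xy).
(* On a one-point space [1 - kappa] may be negative, but both entropies vanish. *)
have pi0 := invariant_law_gt0 _ _ P_stochastic P_irreducible pi_invariant.
have prob1 (m : X -> R) x : is_prob m -> m x = 1.
  case=> _ <-; rewrite (bigD1 x) //= big1 ?addr0 // => y yx.
  by case: single; exists y, x.
have prob_pi (m : X -> R) : is_prob m -> m = pi.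
  by move=> mp; apply/funext => x; rewrite !prob1 //; exact: pi_invariant.1.
rewrite (prob_pi _ (is_prob_push _ _ P_stochastic mup)) (prob_pi _ mup).
by rewrite rel_entropy_refl // mulr0.
Qed.
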